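(* Let $\mathcal B=\{s\subseteq\omega:s\neq\emptyset,\ s\text{ finite},\ |s|=\min s+1\}$ be the Schreier barrier. Then there exist a countable linearly ordered topological space $L$, namely $\omega^{<\omega}$ endowed with the Kleene–Brouwer order (and its order topology), and a function $f:\mathcal B\to L$ such that for no infinite $A\subseteq\omega$ is the set $f[\mathcal B\restriction A]$ discrete.
   Context: $\omega^{<\omega}$ is the set of finite sequences of natural numbers. The Kleene–Brouwer order on it is: $u\le v$ iff $v\subseteq u$ (i.e. $u$ extends $v$), or else $u,v$ are $\subseteq$-incomparable and $u(k)<v(k)$, where $k=\min\{j:u(j)\neq v(j)\}$. $\mathcal B\restriction A=\{s\in\mathcal B:s\subseteq A\}$. A subset of a topological space is discrete if its subspace topology is discrete. *)

(* Defs.v *)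
From HB Require Import structures.
From mathcomp Require Import all_boot all_order finmap.
From mathcomp Require Import all_classical topology.

Set Implicit Arguments.
Unset Strict Implicit.
Unset Printing Implicit Defensive.

Import Order.TTheory.
Local Open Scope classical_set_scope.

Definition min_of (s : {fset nat}) (m : nat) : Prop :=
  m \in s /\ forall k, k \in s -> m <= k.

Definition schreier : set {fset nat} :=
  [set s | s != fset0 /\ exists2 m, min_of s m & #|` s| = m + 1].

(* The type of the elements of [schreier] is its coercion to a subtype. *)
Definition schreier_restr (A : set nat) : set schreier :=
  [set s | [set` \val s] `<=` A].

Definition first_diff (u v : seq nat) : nat :=
  find (fun p => p.1 != p.2) (zip u v).

(* [prefix v u] means that u extends v.  The default value 0 of [nth] is never
   used: [first_diff u v] is smaller than both sizes in the second case. *)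
Definition kb_le (u v : seq nat) : bool :=
  prefix v u ||
  [&& ~~ prefix u v, ~~ prefix v u &
      nth 0 u (first_diff u v) < nth 0 v (first_diff u v)].

(* An alias of [seq nat], to carry the Kleene-Brouwer order. *)
Definition kb_seq : Type := seq nat.

HB.instance Definition _ := Countable.copy kb_seq (seq nat).

Fixpoint kb_rec (u v : seq nat) : bool :=
  match u, v with
  | _, [::] => true
  | [::], _ :: _ => false
  | a :: u', b :: v' => (a < b) || (a == b) && kb_rec u' v'
  end.

Lemma kb_leE u v : kb_le u v = kb_rec u v.
Proof.
elim: u v => [|a u IH] [|b v] //=.
have [eab|nab] := eqVneq a b.
  by rewrite -IH eab ltnn /= /kb_le /first_diff /= !eqxx.
rewrite orbF /kb_le /first_diff /=.
by rewrite nab /= (negbTE nab) eq_sym (negbTE nab).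
Qed.

Lemma kb_le_refl : reflexive kb_le.
Proof. by move=> u; rewrite kb_leE; elim: u => //= a u ->; rewrite eqxx orbT. Qed.

Lemma kb_le_anti : antisymmetric kb_le.
Proof.
move=> u v; rewrite !kb_leE.
elim: u v => [|a u IH] [|b v] //=.
by case: (ltngtP a b) => //= -> /IH ->.
Qed.

Lemma kb_le_trans : transitive kb_le.
Proof.
move=> v u w; rewrite !kb_leE.
elim: u v w => [|a u IH] [|b v] [|c w] //=.
case/orP=> [ab|/andP[/eqP-> uv]]; case/orP=> [bc|/andP[/eqP<- vw]].
- by rewrite (ltn_trans ab bc).
- by rewrite ab.
- by rewrite bc.
- by rewrite eqxx (IH _ _ uv vw) orbT.
Qed.

Lemma kb_le_total : total kb_le.
Proof.
move=> u v; rewrite !kb_leE.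
elim: u v => [|a u IH] [|b v] //=.
by case: (ltngtP a b) => //= _; exact: IH.
Qed.

Fact kb_display : Order.disp_t. Proof. exact: Order.Disp tt tt. Qed.

HB.instance Definition _ :=
  Order.Le_isPOrder.Build kb_display kb_seq kb_le_refl kb_le_anti kb_le_trans.
HB.instance Definition _ :=
  Order.POrder_isTotal.Build kb_display kb_seq kb_le_total.

Definition kb_space : orderTopologicalType kb_display := order_topology kb_seq.

Definition discrete_subset (X : topologicalType) (D : set X) : Prop :=
  forall U : set D, open U.

(* Main.v *)
Require Import Defs.
From mathcomp Require Import all_boot all_order finmap.
From mathcomp Require Import interval.
From mathcomp Require Import all_classical topology.

(** The map sends [s] to the increasing sequence of its elements other than its
    minimum.  Forgetting the minimum makes it possible for one value to extend
    another, although no element of the barrier is an initial segment of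
    another: the length of [s] is dictated by the element that is dropped, so a
    larger minimum leaves room for a longer tail.

    In the Kleene-Brouwer order a sequence [v] is the limit from below of its
    extensions [v ++ n :: r] as [n] grows, whatever the tails [r]
    ([kb_extensions_cvg]).  Given an infinite [A], pick [m < m'] in [A] and then
    [v], a sequence of [m] elements of [A] above [m'].  The set [m :: v] belongs
    to the barrier and has the value [v]; for each large [n] in [A] the sequence
    [m' :: v ++ [:: n]] can be continued inside [A] until it has [m'.+1]
    terms, and then its value is a proper extension of [v].  So [v] is an
    accumulation point of the image of the barrier restricted to [A]. *)

Import Order.TTheory.
Local Open Scope classical_set_scope.

(** At the first difference, either [a] is already smaller than [v], or [v] has
    ended and [a] continues with some [k]; then any [n > k] works. *)
Lemma kb_rec_extensions (a v : seq nat) : kb_rec a v -> a != v ->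
  exists N, forall n r, N <= n -> kb_rec a (v ++ n :: r) && (a != v ++ n :: r).
Proof.
elim: a v => [|k a IH] [|b v] //=.
  move=> _ _; exists k.+1 => n r kn.
  by rewrite kn eqseq_cons ltn_eqF.
case: (ltngtP k b) => //= [kb _ _|<- av].
  by exists 0 => n r _; rewrite eqseq_cons ltn_eqF.
rewrite eqseq_cons eqxx /= => nav.
have [N HN] := IH _ av nav.
by exists N => n r Nn; rewrite eqseq_cons eqxx; exact: HN.
Qed.

Lemma kb_rec_cat (v r : seq nat) : kb_rec (v ++ r) v.
Proof. by elim: v => [|b v IH] /=; [case: r | rewrite eqxx IH orbT]. Qed.

Lemma kb_space_leE (u v : kb_space) : (u <= v)%O = kb_rec u v.
Proof. exact: kb_leE. Qed.

(** Extensions of [v] lie below [v], hence satisfy any upper bound around [v];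
    a lower bound [a] comes from an open interval, so that [a] is strictly below
    [v] and only large first terms [n] matter.  The tails [r] must be arbitrary
    because the barrier prescribes the length of the sequences used later. *)
Lemma kb_extensions_cvg (v : kb_space) (U : set kb_space) : nbhs v U ->
  exists N, forall n r, N <= n -> U ((v : seq nat) ++ n :: r).
Proof.
rewrite itv_nbhsE => -[[l h] [oe vi] iU].
(* Bounds of intervals are compared as [BLeft x < BRight x]: membership in the
   interval is [l <= BLeft x] and [BRight x <= h]. *)
have below_h n r : (BRight ((v : seq nat) ++ n :: r : kb_space) <= h)%O.
  move: vi; rewrite itv_boundlr => /andP[_ vh]; apply: le_trans vh.
  by rewrite bnd_simp kb_space_leE kb_rec_cat.
have above_l : exists N, forall n r, N <= n ->
    (l <= BLeft ((v : seq nat) ++ n :: r : kb_space))%O.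
  move: vi; rewrite itv_boundlr => /andP[lv _].
  case: l oe lv {iU} => [b a /itv_open_ends_lside -> lv|[] _ //]; last by exists 0.
  move: lv; rewrite bnd_simp lt_def kb_space_leE => /andP[nav av].
  rewrite eq_sym in nav; have [N HN] := kb_rec_extensions a v av nav.
  exists N => n r /HN-/(_ r)/andP[H1 H2].
  by rewrite bnd_simp lt_def kb_space_leE H1 eq_sym H2.
have [N HN] := above_l; exists N => n r Nn.
by apply: iU; rewrite /= itv_boundlr HN ?below_h.
Qed.

Lemma discrete_subset_isolated (X : topologicalType) (D : set X) (x : X) :
  discrete_subset D -> D x ->
  exists2 U, nbhs x U & forall y, U y -> D y -> y = x.
Proof.
move=> dD Dx; pose x' : D := exist _ x (mem_set Dx).
have [V oV VE] := dD [set x'].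
exists V.
  apply: open_nbhs_nbhs; split=> //.
  by have : [set x'] x' by []; rewrite -VE.
move=> y Vy Dy; pose y' : D := exist _ y (mem_set Dy).
have : [set x'] y' by rewrite -VE.
by move=> /(congr1 val).
Qed.

Lemma infinite_set_gt (A : set nat) (N : nat) : infinite_set A ->
  exists2 n, A n & N < n.
Proof.
move=> iA.
have /infinite_setN0[n [An nN]] := infinite_setD iA (finite_II N.+1).
by exists n => //; rewrite ltnNge; apply/negP => /nN.
Qed.

Lemma infinite_set_path (A : set nat) (k N : nat) : infinite_set A ->
  exists xs, [/\ path ltn N xs, size xs = k & [set` xs] `<=` A].
Proof.
move=> iA; elim: k N => [|k IH] N; first by exists [::].
have [n An Nn] := infinite_set_gt A N iA.
have [xs [pxs <- xsA]] := IH n.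
exists (n :: xs); split=> //=; first by rewrite Nn.
by move=> z /=; rewrite inE => /predU1P[->//|]; exact: xsA.
Qed.

Definition schreier_tail (s : schreier) : kb_space :=
  behead (sort leq (val s)).

(** The head of the increasing sequence [m :: xs] is its minimum, so [size xs = m]
    is exactly the cardinality condition of the barrier; this is how the values
    of the map on a given [A] are produced. *)
Lemma schreier_of_path (A : set nat) (m : nat) (xs : seq nat) :
  A m -> [set` xs] `<=` A -> path ltn m xs -> size xs = m ->
  exists2 s, schreier_restr A s & schreier_tail s = xs.
Proof.
move=> Am xsA pxs sz; pose s : {fset nat} := seq_fset tt (m :: xs).
have sE z : (z \in s) = (z \in m :: xs) by rewrite seq_fsetE.
have us : uniq (m :: xs).
  by apply: (sorted_uniq ltn_trans ltnn).
have ps : perm_eq s (m :: xs) by apply: uniq_perm; rewrite ?fset_uniq.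
have ss : schreier s.
  split; first by apply/fset0Pn; exists m; rewrite sE mem_head.
  exists m; last by rewrite (perm_size ps) /= sz addn1.
  split=> [|k]; first by rewrite sE mem_head.
  rewrite sE inE => /predU1P[->//|kxs].
  by rewrite ltnW //; apply: (allP (order_path_min ltn_trans pxs)).
exists (exist _ s (mem_set ss)).
  by move=> z /=; rewrite sE inE => /predU1P[->//|]; exact: xsA.
rewrite /schreier_tail /=.
suff -> : sort leq s = m :: xs by [].
apply: (sorted_eq leq_trans anti_leq); first exact: sort_sorted leq_total _.
  by apply: sub_sorted (pxs : sorted ltn (m :: xs)) => a b /ltnW.
by rewrite perm_sort.
Qed.

Theorem proposition3p2 :
  countable [set: kb_space] /\
  exists f : schreier -> kb_space,
    forall A : set nat, infinite_set A ->
      ~ discrete_subset (f @` schreier_restr A).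
Proof.
split; first exact: (@countableP kb_seq).
exists schreier_tail => A iA dA.
have [m Am _] := infinite_set_gt A 0 iA.
have [m' Am' mm'] := infinite_set_gt A m iA.
have [v [pv sv vA]] := infinite_set_path A m m' iA.
have imv : (schreier_tail @` schreier_restr A) v.
  have pmv : path ltn m v.
    by case: v pv {sv vA} => //= x v /andP[m'x ->]; rewrite (ltn_trans mm').
  by have [s sA <-] := schreier_of_path A m v Am vA pmv sv; exists s.
have [U Uv Uiso] := discrete_subset_isolated _ _ _ dA imv.
have [N HN] := kb_extensions_cvg _ _ Uv.
(* Besides being large, [n] has to come after the terms of [v] for
   [m' :: v ++ n :: r] to be increasing. *)
have [n An] := infinite_set_gt A (maxn N (last m' v)) iA.
rewrite gtn_max => /andP[Nn vn].
(* [m' :: v ++ [:: n]] has [m.+2] terms, out of the required [m'.+1]. *)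
have [r [pr sr rA]] := infinite_set_path A (m' - m.+1) n iA.
have imw : (schreier_tail @` schreier_restr A) (v ++ n :: r).
  have wA : [set` v ++ n :: r] `<=` A.
    move=> z /=; rewrite mem_cat inE => /or3P[/vA//|/eqP->//|/rA//].
  have [||s sA <-] := schreier_of_path A m' (v ++ n :: r) Am' wA.
  - by rewrite cat_path pv /= vn.
  - by rewrite size_cat /= sv sr addnS -addSn subnKC.
  by exists s.
have /(congr1 size) := Uiso _ (HN n r (ltnW Nn)) imw.
by rewrite size_cat /= => /eqP; rewrite -[X in _ == X]addn0 eqn_add2l.
Qed.
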